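(* For all positive integers $n$ and $N$, $$\sum_{\substack{j_1+j_2+\cdots+j_N=n\\ j_1,j_2,\ldots,j_N\geqslant 0}} b_{j_1}b_{j_2}\cdots b_{j_N}=\sum_{k=0}^{N-1}a_{k}^{(N)}(n)\,b_{n-k},$$ where $b_j$ are the Bernoulli numbers of the second kind and $a_k^{(N)}(x)$ are the polynomials defined in the context.
   Context: The Bernoulli numbers of the second kind $b_0,b_1,b_2,\ldots$ are defined by $\sum_{n=0}^\infty b_nt^n=\frac{t}{\log(1+t)}$, and one sets $b_k=0$ for $k<0$. Define an array of polynomials $\{a_k^{(N)}(x)\}$ (for integers $N\geqslant 1$ and $k$) by $a_0^{(1)}(x)=1$; $a_k^{(N)}(x)=0$ for $k<0$ and for $k\geqslant N$; and, for $N\geqslant 2$ and $0\leqslant k<N$, $$a_{k}^{(N)}(x)=-\frac{1}{N-1}\Big((x-N+1)\,a_{k}^{(N-1)}(x)+(x-N)\,a_{k-1}^{(N-1)}(x-1)\Big).$$ *)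

(* Defs.v *)
From HB Require Import structures.
From mathcomp Require Import all_boot all_order all_algebra.
Set Implicit Arguments.
Unset Strict Implicit.
Unset Printing Implicit Defensive.
Import Order.TTheory GRing.Theory Num.Theory.
Local Open Scope ring_scope.

(* A formal power series over the rationals is the sequence of its
   coefficients. *)
Definition fps_mul (f g : nat -> rat) : nat -> rat :=
  fun n => \sum_(i < n.+1) f i * g (n - i)%N.

Definition fps_t : nat -> rat := fun n => (n == 1%N)%:R.

(* log(1+t) = t - t^2/2 + t^3/3 - ... *)
Definition fps_log1p : nat -> rat :=
  fun n => if n is m.+1 then (-1) ^+ m / m.+1%:R else 0.

(* log(1+t) has no constant term, so it is not a unit of Q[[t]]: the quotient
   t / log(1+t) is the series F such that F * log(1+t) = t.  The sequence is
   indexed by the integers, with value 0 at negative indices. *)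
Definition bernoulli_second_kind (b : int -> rat) : Prop :=
  (forall k : int, k < 0 -> b k = 0) /\
  fps_mul (fun n : nat => b n%:Z) fps_log1p =1 fps_t.

Lemma bernoulli_second_kind_rec (f : nat -> rat) :
  fps_mul f fps_log1p =1 fps_t <->
  (forall n, f n = (n == 0%N)%:R - \sum_(i < n) f i * fps_log1p (n.+1 - i)%N).
Proof.
have E n : fps_mul f fps_log1p n.+1 =
    \sum_(i < n) f i * fps_log1p (n.+1 - i)%N + f n.
  rewrite /fps_mul big_ord_recr /= subnn mulr0 addr0 big_ord_recr /=.
  by rewrite subSn // subnn /= expr0 mul1r invr1 mulr1.
split=> [H n | H [|n]].
- by move: (H n.+1); rewrite E /fps_t eqSS => <-; rewrite addrAC subrr add0r.
- by rewrite /fps_mul big_ord1 mulr0.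
- by rewrite E [f n]H addrCA subrr addr0 /fps_t eqSS.
Qed.

Lemma bernoulli_second_kind_exists : exists b, bernoulli_second_kind b.
Proof.
pose step (s : seq rat) := rcons s ((size s == 0%N)%:R
  - \sum_(i < size s) s`_i * fps_log1p ((size s).+1 - i)%N).
pose s n := iter n step [::].
have size_s n : size (s n) = n by elim: n => //= n IH; rewrite size_rcons IH.
have nth_s n i : (i < n)%N -> (s n)`_i = (s i.+1)`_i.
  elim: n => // n IH; rewrite ltnS leq_eqVlt => /orP[/eqP-> // | lt_in].
  by rewrite /= nth_rcons size_s lt_in IH.
exists (fun k => if k is Posz n then (s n.+1)`_n else 0); split; first by case.
apply/bernoulli_second_kind_rec => n.
rewrite /= nth_rcons size_s ltnn eqxx; congr (_ - _).
by apply: eq_bigr => i _; rewrite nth_s.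
Qed.

Lemma bernoulli_second_kind_unique b c :
  bernoulli_second_kind b -> bernoulli_second_kind c -> b =1 c.
Proof.
move=> [b0 /bernoulli_second_kind_rec bE] [c0 /bernoulli_second_kind_rec cE].
case=> n; last by rewrite b0 ?c0.
elim/ltn_ind: n => n IH; rewrite bE cE; congr (_ - _).
by apply: eq_bigr => i _; rewrite IH.
Qed.

(* a_poly N k is a_k^(N)(x), for N >= 1; the value at N = 0 is a dummy. *)
Fixpoint a_poly (N : nat) (k : int) : {poly rat} :=
  match N with
  | 0 => 0
  | 1 => if k == 0 then 1 else 0
  | M.+1 =>
      if (0 <= k) && (k < N%:Z) then
        - (N%:R - 1)^-1 *:
          (('X - N%:R + 1) * a_poly M k
           + ('X - N%:R) * (a_poly M (k - 1) \Po ('X - 1)))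
      else 0
  end.

(* Main.v *)
Require Import Defs.
From mathcomp Require Import all_boot all_order all_algebra.
From mathcomp Require Import ring zify.
Import Order.TTheory GRing.Theory Num.Theory.
Local Open Scope ring_scope.

(** With [F = t / log(1+t)], logarithmic differentiation gives
    [F^2 = (1+t) (F - t F')], hence
    [N F^(N+1) = (1+t) (N F^N - t (F^N)')].  Taking coefficients, the
    [c_N n] of [F^N] satisfy
    [N c_(N+1) n = - ((n - N) c_N n + (n - 1 - N) c_N (n - 1))], and the
    recursion defining [a_k^(N)] is precisely the one that makes
    [\sum_k a_k^(N)(n) b_(n-k)] satisfy the same recurrence.  Power series are
    replaced by polynomials modulo ['X^m]. *)

(** The explicit cofactor [r] turns agreement of low coefficients into a polynomial identity, which
    can be differentiated and passed to [ring]. *)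
Lemma eq_modXn (R : nzRingType) (m : nat) (p q : {poly R}) :
  (forall i, (i < m)%N -> p`_i = q`_i) -> exists r, p = q + r * 'X^m.
Proof.
move=> pq; exists (drop_poly m (p - q)).
rewrite -[LHS](subrK q) addrC; congr (_ + _).
rewrite -[LHS](poly_take_drop m) (_ : take_poly m _ = 0) ?add0r //.
apply/polyP => i; rewrite coef_take_poly coefB coef0.
by case: ltnP => // /pq ->; rewrite subrr.
Qed.

(** Expanding the power picks one monomial per factor; the choice [j] contributes to the degree
    given by the sum of its values. *)
Lemma coef_poly_exp_sum (R : comNzRingType) (f : nat -> R) (m N i : nat) :
  ((\poly_(j < m) f j) ^+ N)`_i
  = \sum_(j : {ffun 'I_N -> 'I_m} | (\sum_(k < N) j k)%N == i)
       \prod_(k < N) f (j k).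
Proof.
rewrite poly_def -[N in LHS]card_ord -prodr_const bigA_distr_bigA coef_sum.
rewrite [RHS]big_mkcond; apply: eq_bigr => j _.
under eq_bigr do rewrite -mul_polyC.
rewrite big_split /= prodrXr -rmorph_prod mul_polyC coefZ coefXn eq_sym.
by case: eqP; rewrite ?mulr1 ?mulr0.
Qed.

Lemma a_poly_out (N : nat) (k : int) : (k < 0) || (N%:Z <= k) -> a_poly N k = 0.
Proof.
by case: N => [|[|N]] // out; rewrite /= ifF //; lia.
Qed.

Lemma a_poly_rec (N : nat) (k : int) (x : rat) : (0 < N)%N ->
  N%:R * (a_poly N.+1 k).[x]
  = (N%:R - x) * (a_poly N k).[x] + (N%:R + 1 - x) * (a_poly N (k - 1)).[x - 1].
Proof.
case: N => // N _.
have -> : a_poly N.+2 k = if (0 <= k) && (k < N.+2%:Z) then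
    - (N.+2%:R - 1)^-1 *: (('X - N.+2%:R + 1) * a_poly N.+1 k
      + ('X - N.+2%:R) * (a_poly N.+1 (k - 1) \Po ('X - 1))) else 0 by [].
case: ifPn => [_ | out_k]; last first.
  by rewrite !a_poly_out ?horner0 ?mulr0 ?addr0 //; lia.
have nz : N.+1%:R != 0 :> rat by rewrite pnatr_eq0.
rewrite -!polyC_natr -polyC1.
rewrite !(horner_comp, hornerZ, hornerD, hornerN, hornerM, hornerX, hornerC).
rewrite (_ : N.+2%:R - 1 = N.+1%:R); last by ring.
rewrite mulrA mulrN divff //; ring.
Qed.

Section PowerCoefficients.

Variables (b : int -> rat) (hb : bernoulli_second_kind b).

Definition bernoulli_poly (m : nat) : {poly rat} := \poly_(i < m) b i%:Z.

(* log(1+t) / t, truncated *)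
Definition log1p_quot_poly (m : nat) : {poly rat} :=
  \poly_(i < m) ((-1) ^+ i / i.+1%:R).

Lemma bernoulli_poly_log1p_quot (m i : nat) : (i < m)%N ->
  (bernoulli_poly m * log1p_quot_poly m)`_i = (1 : {poly rat})`_i.
Proof.
move=> lt_im; have := hb.2 i.+1.
rewrite /fps_mul big_ord_recr /= subnn mulr0 addr0 /fps_t eqSS coef1 => <-.
rewrite coefM; apply: eq_bigr => j _; have := ltn_ord j => lt_ji.
by rewrite !coef_poly subSn ?(leq_trans lt_ji) ?(leq_ltn_trans (leq_subr _ _)).
Qed.

(** For L = log(1+t)/t this is (1+t)(tL)' = 1, the derivative of the logarithm. *)
Lemma log1p_quot_ode (m i : nat) : (i < m)%N ->
  ((1 + 'X) * (log1p_quot_poly m + 'X * (log1p_quot_poly m)^`()))`_i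
  = (1 : {poly rat})`_i.
Proof.
have coefE j : (j < m)%N ->
    (log1p_quot_poly m + 'X * (log1p_quot_poly m)^`())`_j = (-1) ^+ j.
  move=> lt_jm; rewrite coefD coefXM coef_deriv !coef_poly.
  case: j lt_jm => [|j] lt_jm; rewrite lt_jm /= ?expr0 ?divr1 ?addr0 //.
  by rewrite -mulrS -[LHS]mulr_natr mulfVK ?pnatr_eq0 //.
move=> lt_im; rewrite mulrDl mul1r coefD coefXM coef1 coefE //.
case: i lt_im => [|i] lt_im; first by rewrite addr0.
by rewrite coefE 1?ltnW //= exprS mulN1r addNr.
Qed.

(** Multiply (1+t)(L + tL') = 1 by P^2, then use PL = 1 and its derivative in the form P^2 L' =
    -P'. *)
Lemma bernoulli_poly_sqr (m : nat) : exists r : {poly rat},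
  let P := bernoulli_poly m in
  P ^+ 2 = (1 + 'X) * (P - 'X * P^`()) + r * 'X^m.
Proof.
set P := bernoulli_poly m; pose L := log1p_quot_poly m.
have [r PL] := eq_modXn _ _ _ _ (bernoulli_poly_log1p_quot m).
have [s ode] := eq_modXn _ _ _ _ (log1p_quot_ode m).
rewrite -/P -/L in PL ode.
(* The factor ['X] restores the degree lost in differentiating ['X^m], so the precision stays at
   [m]. *)
have PL' : 'X * (P^`() * L + P * L^`()) = ('X * r^`() + r *+ m) * 'X^m.
  have -> : P^`() * L + P * L^`() = r^`() * 'X^m + r * 'X^m^`().
    by rewrite -[LHS]derivM PL derivD derivM -polyC1 derivC add0r.
  rewrite derivXn; case: m {P L PL ode} => [|m] /=.
    by rewrite !mulr0n; ring.
  by rewrite exprS; ring.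
(* This witness collects the remainders of the three relations [PL], [ode] and [PL'], weighted as in
   the combination below. *)
exists ((1 + 'X) * P * r - P ^+ 2 * s - (1 + 'X) * 'X * P^`() * r
        + (1 + 'X) * P * ('X * r^`() + r *+ m)) => /=.
apply/eqP; rewrite -subr_eq0; apply/eqP.
transitivity ((1 + 'X) * (P - 'X * P^`()) * (P * L - (1 + r * 'X^m))
  - P ^+ 2 * ((1 + 'X) * (L + 'X * L^`()) - (1 + s * 'X^m))
  + (1 + 'X) * P * ('X * (P^`() * L + P * L^`())
                    - ('X * r^`() + r *+ m) * 'X^m)).
  by ring.
by rewrite PL ode PL' !subrr !mulr0 subrr addr0.
Qed.

Lemma coef_bernoulli_poly_exp_rec (m N i : nat) : (i < m)%N ->
  N%:R * (bernoulli_poly m ^+ N.+1)`_i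
  = (N%:R - i%:R) * (bernoulli_poly m ^+ N)`_i
    + (if i is j.+1 then (N%:R - j%:R) * (bernoulli_poly m ^+ N)`_j else 0).
Proof.
move=> lt_im; case: N => [|N].
  by case: i lt_im => [|[|i]] _ /=; rewrite ?coef1 /=; ring.
have [r] := bernoulli_poly_sqr m; set P := bernoulli_poly m => /= sqrP.
(* This is the square identity multiplied by (N+1) P^N. *)
have : N.+1%:R * P ^+ N.+2
    = N.+1%:R * P ^+ N.+1 - 'X * (P ^+ N.+1)^`()
      + 'X * (N.+1%:R * P ^+ N.+1 - 'X * (P ^+ N.+1)^`())
      + N.+1%:R * P ^+ N * r * 'X^m.
  have -> : P ^+ N.+2 = P ^+ N * P ^+ 2 by rewrite -exprD addn2.
  by rewrite sqrP deriv_exp /= exprS; ring.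
move=> /(congr1 (fun p : {poly rat} => p`_i)).
rewrite !mulr_natl.
case: i lt_im => [|[|i]] lt_im;
  rewrite !(coefD, coefB, coefN, coefXM, coefMXn, coefMn, coef_deriv) lt_im /= => ->;
  ring.
Qed.

Definition bernoulli_comb (N : nat) (x : int) : rat :=
  \sum_(k < N) (a_poly N k%:Z).[x%:~R] * b (x - k%:Z).

Lemma bernoulli_comb_neg (N : nat) (x : int) : x < 0 -> bernoulli_comb N x = 0.
Proof.
by move=> x_lt0; apply: big1 => k _; rewrite hb.1 ?mulr0 //; lia.
Qed.

Lemma bernoulli_comb_rec (N : nat) (x : int) : (0 < N)%N ->
  N%:R * bernoulli_comb N.+1 x
  = (N%:R - x%:~R) * bernoulli_comb N x
    + (N%:R + 1 - x%:~R) * bernoulli_comb N (x - 1).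
Proof.
move=> N_gt0; rewrite /bernoulli_comb mulr_sumr.
under eq_bigr do rewrite mulrA a_poly_rec // mulrDl -!mulrA.
rewrite big_split /= -!mulr_sumr; congr (_ * _ + _ * _).
  by rewrite big_ord_recr /= a_poly_out ?horner0 ?mul0r ?addr0 // lexx orbT.
(* In the second sum the index -1 gives zero; shifting k by one then matches b_(x-(k+1)) with
   b_((x-1)-k). *)
rewrite big_ord_recl /= a_poly_out // horner0 mul0r add0r.
apply: eq_bigr => k _; rewrite /bump /= rmorphB /=.
by congr ((a_poly _ _).[_] * b _); lia.
Qed.

Lemma coef_bernoulli_poly_exp (m N i : nat) : (0 < N)%N -> (i < m)%N ->
  (bernoulli_poly m ^+ N)`_i = bernoulli_comb N i%:Z.
Proof.
(* Induction starts at exponent 1, where a_0 = 1 leaves the single term b_i. *)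
case: N => // N _; elim: N i => [|N IH] i lt_im.
  by rewrite expr1 coef_poly lt_im /bernoulli_comb big_ord1 /= hornerE mul1r subr0.
have nz : N.+1%:R != 0 :> rat by rewrite pnatr_eq0.
apply: (mulfI nz); rewrite coef_bernoulli_poly_exp_rec // bernoulli_comb_rec //.
rewrite IH //; congr (_ + _); case: i lt_im => [|i] lt_im.
  (* At i = 0 the recurrence reaches the index -1, where b vanishes. *)
  by rewrite bernoulli_comb_neg ?mulr0.
rewrite IH 1?ltnW // (_ : i.+1%:Z - 1 = i%:Z); last by lia.
by congr (_ * _); rewrite -[i.+1]addn1 PoszD rmorphD /=; ring.
Qed.

End PowerCoefficients.

(* Since the j_i are nonnegative with sum n, each lies in {0, ..., n}. *)
Theorem theorem1 (b : int -> rat) (hb : bernoulli_second_kind b)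
    (n N : nat) (hn : (0 < n)%N) (hN : (0 < N)%N) :
  \sum_(j : {ffun 'I_N -> 'I_n.+1} | (\sum_(i < N) j i)%N == n)
     \prod_(i < N) b (j i : nat)%:Z
  = \sum_(k < N) (a_poly N k%:Z).[n%:R] * b (n%:Z - k%:Z).
Proof.
rewrite -(coef_poly_exp_sum _ (fun j => b j%:Z)).
exact: coef_bernoulli_poly_exp.
Qed.
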